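(* Let $\Lambda\in\mathbb{R}$ and let $\rho,p,q$ be smooth real functions of a real variable $z$, defined on an open interval containing $z=0$, and write $\rho_0=\rho(0)$, $p_0=p(0)$, $q_0=q(0)$. Consider the energy-momentum tensor $(T^{\mu}_{\nu})=\mathrm{diag}\{\rho(z),-p(z),-p(z),-q(z)\}$ in coordinates $(t,x,y,z)$. Assume it is generic at $z=0$, i.e. \[ q_0\neq\Lambda \quad\text{and}\quad \big[\ \rho_0\neq q_0-2\Lambda \ \text{ or } \ \rho_0+4p_0+3q_0\neq 6\Lambda\ \big], \] and fix a constant $z_S$ with \[ \frac{q_0-\Lambda}{z_S}<0 \qquad\text{and}\qquad 3z_S(\rho_0-q_0+2\Lambda)\neq \rho_0+4p_0+3q_0-6\Lambda . \] Then there is a maximal open interval $I_0$ containing $z=0$ on which the function \[ \Phi(z)=\frac{q(z)-\Lambda}{z-z_S}\cdot\frac{1}{3(z-z_S)\big(\rho(z)-q(z)+2\Lambda\big)+\rho(z)+4p(z)+3q(z)-6\Lambda} \] is well defined and $\dfrac{q(z)-\Lambda}{z-z_S}>0$. Furthermore, the metric \[ g=e^{2\int_0^z \left(3(z'-z_S)-1\right)\Phi(z')\,dz'}\,dt^2-e^{4\int_0^z\Phi(z')\,dz'}\,(dx^2+dy^2)-\frac{12\,(z-z_S)}{q(z)-\Lambda}\,\Phi(z)^2\,dz^2, \] defined for $z\in I_0$, satisfies Einstein's equations with cosmological constant $\Lambda$, \[ R^{\mu}_{\nu}-\tfrac12 R\,\delta^{\mu}_{\nu}-\Lambda\,\delta^{\mu}_{\nu}=T^{\mu}_{\nu},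 \] provided the energy-momentum tensor is conserved, $\nabla_\mu T^{\mu}_{\nu}=0$, which (for this metric) is equivalent to \[ \frac{dq}{dz}=\Big[\big(1-3(z-z_S)\big)(\rho+q)+4(p-q)\Big]\Phi . \]
   Context: Units are chosen so that $8\pi G/c^4=1$. The metric has signature $(+,-,-,-)$. The Levi-Civita connection $\Gamma$ of $g$ is used, with Riemann tensor $R^{\lambda}{}_{\mu\kappa\nu}=\partial_\kappa\Gamma^\lambda_{\nu\mu}-\partial_\nu\Gamma^\lambda_{\kappa\mu}+\Gamma^\lambda_{\kappa\sigma}\Gamma^\sigma_{\nu\mu}-\Gamma^\lambda_{\nu\sigma}\Gamma^\sigma_{\kappa\mu}$, Ricci tensor $R_{\mu\nu}=R^{\lambda}{}_{\mu\lambda\nu}$, $R^\mu_\nu=g^{\mu\alpha}R_{\alpha\nu}$, and scalar curvature $R=R^\mu_\mu$. $\nabla$ denotes the covariant derivative of $g$. *)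

(* Defs.v *)
From HB Require Import structures.
From mathcomp Require Import all_boot all_order all_algebra.
From mathcomp Require Import all_classical all_reals all_analysis.
Set Implicit Arguments. Unset Strict Implicit. Unset Printing Implicit Defensive.
Import Order.TTheory GRing.Theory Num.Theory.
Import numFieldNormedType.Exports.
Local Open Scope classical_set_scope.
Local Open Scope ring_scope.

Section Geometry.
Variable R : realType.

(* Spacetime points: row vectors (t, x, y, z) indexed 0,1,2,3. *)
Definition pt := 'rV[R]_4.
Definition coord (x : pt) (k : 'I_4) : R := x ord0 k.
Definition zcoord (x : pt) : R := x ord0 (@Ordinal 4 3 isT).

Definition pd (k : 'I_4) (f : pt -> R) (x : pt) : R :=
  derive f x (delta_mx 0 k).

Definition ginv (g : pt -> 'M[R]_4) (x : pt) : 'M[R]_4 := invmx (g x).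

Definition Gamma (g : pt -> 'M[R]_4) (x : pt) (l m n : 'I_4) : R :=
  2^-1 * \sum_(s < 4) ginv g x l s *
    (pd m (fun y => g y s n) x + pd n (fun y => g y s m) x
     - pd s (fun y => g y m n) x).

Definition Riemann (g : pt -> 'M[R]_4) (x : pt) (l m k n : 'I_4) : R :=
  pd k (fun y => Gamma g y l n m) x - pd n (fun y => Gamma g y l k m) x
  + \sum_(s < 4) (Gamma g x l k s * Gamma g x s n m
                  - Gamma g x l n s * Gamma g x s k m).

Definition Ricci (g : pt -> 'M[R]_4) (x : pt) (m n : 'I_4) : R :=
  \sum_(l < 4) Riemann g x l m l n.

Definition RicciUp (g : pt -> 'M[R]_4) (x : pt) (m n : 'I_4) : R :=
  \sum_(a < 4) ginv g x m a * Ricci g x a n.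

Definition scalarCurv (g : pt -> 'M[R]_4) (x : pt) : R :=
  \sum_(m < 4) RicciUp g x m m.

Definition einstein_eqs (g : pt -> 'M[R]_4) (Lam : R)
    (T : pt -> 'M[R]_4) (x : pt) : Prop :=
  forall m n : 'I_4,
    RicciUp g x m n - 2^-1 * scalarCurv g x * (m == n)%:R
      - Lam * (m == n)%:R = T x m n.

Definition divT (g : pt -> 'M[R]_4) (T : pt -> 'M[R]_4) (x : pt) (n : 'I_4) : R :=
  \sum_(m < 4) pd m (fun y => T y m n) x
  + \sum_(m < 4) \sum_(s < 4)
      (Gamma g x m m s * T x s n - Gamma g x s m n * T x m s).

Definition Tmat (rho p q : R -> R) (x : pt) : 'M[R]_4 :=
  \matrix_(i < 4, j < 4)
    if i == j then
      (if val i == 0%N then rho (zcoord x)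
       else if val i == 3%N then - q (zcoord x) else - p (zcoord x))
    else 0.

Definition oint (a b : R) (f : R -> R) : R :=
  if a <= b then \int[lebesgue_measure]_(s in `[a, b]) f s
  else - \int[lebesgue_measure]_(s in `[b, a]) f s.

Definition smooth_on (a b : \bar R) (f : R -> R) : Prop :=
  forall (n : nat) (z : R), (a < z%:E < b)%E -> derivable (derive1n n f) z 1.

Definition Dden (Lam zS : R) (rho p q : R -> R) (z : R) : R :=
  3 * (z - zS) * (rho z - q z + 2 * Lam) + rho z + 4 * p z + 3 * q z - 6 * Lam.

Definition Phi (Lam zS : R) (rho p q : R -> R) (z : R) : R :=
  (q z - Lam) / (z - zS) * (Dden Lam zS rho p q z)^-1.

Definition good (a b : \bar R) (Lam zS : R) (rho p q : R -> R) (z : R) : Prop :=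
  (a < z%:E < b)%E /\ z != zS /\ Dden Lam zS rho p q z != 0
  /\ 0 < (q z - Lam) / (z - zS).

(* The metric (formula taken literally at every point; only used for z in I0) *)
Definition metric (Lam zS : R) (rho p q : R -> R) (x : pt) : 'M[R]_4 :=
  let z := zcoord x in
  let F := Phi Lam zS rho p q in
  \matrix_(i < 4, j < 4)
    if i == j then
      (if val i == 0%N then
         expR (2 * oint 0 z (fun s => (3 * (s - zS) - 1) * F s))
       else if val i == 3%N then
         - (12 * (z - zS) / (q z - Lam) * (F z) ^+ 2)
       else - expR (4 * oint 0 z F))
    else 0.

End Geometry.

(* Main.v *)
(** Let a diagonal metric have entries [A_i] depending on [z] only, with
    [A_i' = 2 h_i A_i].  Its curvature is carried by the coordinate planes, and
    its Einstein tensor is diagonal, [G^n_n] being minus the sum of the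
    curvatures of the planes orthogonal to [n].  For [diag(A, -B, -B, -C)] with
    slopes [a], [b], [c], Einstein's equations thus reduce to three, of which the
    [z] one, [b^2 + 2 a b = (q - Lam) C], is how [C] is chosen here.  The
    conservation law turns [c] into
    [Phi' / Phi + 3 Phi (1 + (z - zS) (rho + Lam) / (q - Lam))]; then [Phi']
    cancels from the other two, the [t] equation holds, and the transverse one
    becomes the definition of [Phi]. *)
Require Import Defs.
From HB Require Import structures.
From mathcomp Require Import all_boot all_order all_algebra.
From mathcomp Require Import all_classical all_reals all_analysis.
From mathcomp Require Import ring lra.
Set Implicit Arguments. Unset Strict Implicit. Unset Printing Implicit Defensive.
Import Order.TTheory GRing.Theory Num.Theory.
Import numFieldNormedType.Exports.
Local Open Scope classical_set_scope.
Local Open Scope ring_scope.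

Section RealIntervals.
Variable R : realType.
Implicit Types (l u : \bar R) (c x y z : R) (f : R -> R).

Definition ereal_itv l u : set R := [set z | (l < z%:E < u)%E].

Lemma open_ereal_itv l u : open (ereal_itv l u).
Proof.
rewrite (_ : ereal_itv l u = [set z | l < z%:E]%E `&` [set z | z%:E < u]%E).
  by apply: openI; [exact: open_ereal_gt | exact: open_ereal_lt].
by apply/seteqP; split=> z /andP.
Qed.

Lemma nbhs_ereal_itv l u z : ereal_itv l u z -> nbhs z (ereal_itv l u).
Proof.
by move=> luz; apply: open_nbhs_nbhs; split=> //; exact: open_ereal_itv.
Qed.

Lemma segment_ereal_itv l u c z : ereal_itv l u c -> ereal_itv l u z ->
  exists x y, [/\ x < c < y, x < z < y & `[x, y] `<=` ereal_itv l u].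
Proof.
move=> luc luz; pose m := Num.min c z; pose M := Num.max c z.
have lum : ereal_itv l u m by rewrite /m /Num.min; case: ifP.
have luM : ereal_itv l u M by rewrite /M /Num.max; case: ifP.
have [x [xm /andP[lx _]]] : exists x, x < m /\ ereal_itv l u x.
  near m^'- => x; exists x; split; near: x; first exact: nbhs_left_lt.
  exact/cvg_within/nbhs_ereal_itv.
have [y [My /andP[_ yu]]] : exists y, M < y /\ ereal_itv l u y.
  near M^'+ => y; exists y; split; near: y; first exact: nbhs_right_gt.
  exact/cvg_within/nbhs_ereal_itv.
exists x, y; move: xm My; rewrite lt_min gt_max.
move=> /andP[-> ->] /andP[-> ->]; split=> // w.
rewrite /= in_itv /= => /andP[xw wy]; apply/andP; split.
  by rewrite (lt_le_trans lx) // lee_fin.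
by rewrite (le_lt_trans _ yu) // lee_fin.
Unshelve. all: by end_near. Qed.

Lemma maximal_ereal_itv (P : set R) c : nbhs c P ->
  exists l u, [/\ ereal_itv l u c, ereal_itv l u `<=` P &
    forall l' u', ereal_itv l' u' c -> ereal_itv l' u' `<=` P ->
      (l <= l')%E /\ (u' <= u)%E].
Proof.
move=> /nbhs_ballP[e /= e0 ceP].
pose L := [set l | ereal_itv l c%:E `<=` P]%E.
pose U := [set u | ereal_itv c%:E u `<=` P]%E.
exists (ereal_inf L), (ereal_sup U); split.
- apply/andP; split.
  + apply: (@le_lt_trans _ _ (c - e)%:E); last by rewrite lte_fin; lra.
    apply: ereal_inf_lbound => z /andP[]; rewrite !lte_fin => ez zc.
    by apply: ceP; rewrite /ball /= ger0_norm; lra.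
  + apply: (@lt_le_trans _ _ (c + e)%:E); first by rewrite lte_fin; lra.
    apply: ereal_sup_ubound => z /andP[]; rewrite !lte_fin => cz ze.
    by apply: ceP; rewrite /ball /= ler0_norm; lra.
- move=> z /andP[lz zu]; have [zc|cz|->] := ltgtP z c.
  + have [l LP lltz] := ereal_inf_lt lz.
    by apply: LP; rewrite /ereal_itv /= lltz lte_fin.
  + have [u UP zltu] := ereal_sup_gt zu.
    by apply: UP; rewrite /ereal_itv /= zltu lte_fin cz.
  + by apply: ceP; exact: ballxx.
- move=> l' u' /andP[l'c cu'] l'u'P; split.
  + apply: ereal_inf_lbound => z /andP[l'z zc]; apply: l'u'P.
    by rewrite /ereal_itv /= l'z (lt_trans zc).
  + apply: ereal_sup_ubound => z /andP[cz zu']; apply: l'u'P.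
    by rewrite /ereal_itv /= zu' (lt_trans l'c).
Qed.

Lemma ointE f x y c z :
  lebesgue_measure.-integrable `[x, y] (EFin \o f) ->
  x <= c <= y -> x <= z <= y ->
  oint c z f = \int[lebesgue_measure]_(s in `[x, z]) f s
    - \int[lebesgue_measure]_(s in `[x, c]) f s.
Proof.
move=> fint /andP[xc cy] /andP[xz zy].
have integrable_sub (v w : R) : x <= v -> w <= y ->
    lebesgue_measure.-integrable `[v, w] (EFin \o f).
  move=> xv wy; apply: integrableS fint => //.
  by apply: subset_itv; rewrite bnd_simp.
have RintegralB (v w : R) : x <= v -> v <= w -> w <= y ->
    \int[lebesgue_measure]_(s in `[v, w]) f s =
    \int[lebesgue_measure]_(s in `[x, w]) f s
    - \int[lebesgue_measure]_(s in `[x, v]) f s.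
  move=> xv vw wy.
  rewrite Rintegral_itvB ?bnd_simp //; last exact: integrable_sub.
  rewrite Rintegral_itv_obnd_cbnd //.
  apply: integrableS (integrable_sub v w xv wy) => //.
  by apply: subset_itvr; rewrite bnd_simp.
by rewrite /oint; case: leP => [cz|/ltW zc]; rewrite RintegralB ?opprB.
Qed.

Lemma is_derive_oint_segment f x y c z : {within `[x, y], continuous f} ->
  x < c < y -> x < z < y -> is_derive z 1 (oint c ^~ f) (f z).
Proof.
move=> cf /andP[xc cy] /andP[xz zy].
have fint : lebesgue_measure.-integrable `[x, y] (EFin \o f).
  exact: continuous_compact_integrable (@segment_compact _ x y) cf.
have fz : {for z, continuous f}.
  have /(_ cf)[+ _ _] := (continuous_within_itvP f (lt_trans xz zy)).1.
  by apply; rewrite in_itv /= xz.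
have [dF FE] := continuous_FTC1_closed zy fint xz fz.
pose k := \int[lebesgue_measure]_(s in `[x, c]) f s.
apply: (@near_eq_is_derive _ _ _
    (fun w => \int[lebesgue_measure]_(s in `[x, w]) f s - k)); last first.
  rewrite -[f z]subr0; apply: is_deriveB.
  by apply: DeriveDef => //; rewrite -derive1E.
near=> w; apply/esym/(ointE fint); apply/andP; split; apply: ltW => //.
- by near: w; exact: lt_nbhsr.
- by near: w; exact: lt_nbhsl.
Unshelve. all: by end_near. Qed.

Lemma is_derive_oint l u f c z : {in ereal_itv l u, continuous f} ->
  ereal_itv l u c -> ereal_itv l u z -> is_derive z 1 (oint c ^~ f) (f z).
Proof.
move=> cf luc luz; have [x [y [xcy xzy xylu]]] := segment_ereal_itv luc luz.
apply: is_derive_oint_segment xcy xzy.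
apply: continuous_in_subspaceT => w; rewrite !inE => /xylu ?; apply: cf.
by rewrite inE.
Qed.

End RealIntervals.

Lemma invmx_diag (F : fieldType) n (d : 'rV[F]_n) :
  (forall i, d 0 i != 0) -> invmx (diag_mx d) = diag_mx (\row_i (d 0 i)^-1).
Proof.
move=> d0; set e := diag_mx (\row_i _).
have de : diag_mx d *m e = 1%:M.
  rewrite mulmx_diag -diag_const_mx; congr diag_mx.
  by apply/rowP => i; rewrite !mxE divff.
have [du _] := mulmx1_unit de.
by rewrite -[LHS]mulmx1 -de mulKmx.
Qed.

Local Notation zidx := (@Ordinal 4 3 isT).

Section Derive.
Variable R : realType.

Lemma derivable_continuous_at (f : R -> R) z :
  derivable f z 1 -> {for z, continuous f}.
Proof. by move=> /derivable1_diffP/differentiable_continuous. Qed.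

Lemma derive1_mulrb (f : R -> R) (b : bool) z :
  derive1 (fun w => f w *+ b) z = derive1 f z *+ b.
Proof. by case: b => //; rewrite mulr0n derive1E; exact: derive_cst. Qed.

Lemma derive_coord n (f : R -> R) (x : 'rV[R]_n) (j k : 'I_n) :
  derive (fun y : 'rV[R]_n => f (y 0 j)) x (delta_mx 0 k) =
  derive1 f (x 0 j) *+ (k == j).
Proof.
have coordD (h : R) : (h *: delta_mx 0 k + x) 0 j = h *+ (k == j) + x 0 j.
  by rewrite !mxE eqxx /= eq_sym mulr_natr.
rewrite /derive; under eq_fun do rewrite /= coordD.
case: eqP => _ //=.
under eq_fun do rewrite add0r subrr scaler0.
exact: lim_cst.
Qed.

Lemma pd_zcoord (k : 'I_4) (f : R -> R) (x : pt R) :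
  pd k (fun y => f (zcoord y)) x = derive1 f (zcoord x) *+ (k == zidx).
Proof. exact: derive_coord. Qed.

Lemma near_zcoord (P : set R) (x : pt R) :
  (\forall z \near zcoord x, P z) -> \forall y \near x, P (zcoord y).
Proof. exact: coord_continuous. Qed.

End Derive.

Section LogSlope.
Variable R : realType.
Implicit Types (f h : R -> R) (z : R).

(* [h] is the logarithmic derivative of the scale factor [sqrt `|f|]. *)
Definition log_slope f h z := f z != 0 /\ is_derive z 1 f (2 * h z * f z).

Lemma log_slopeN f h z : log_slope f h z -> log_slope (\- f) h z.
Proof.
move=> [f0 df]; split; first by rewrite oppr_eq0.
by rewrite mulrN; exact: is_deriveN.
Qed.

Lemma log_slope_expR f h z :
  is_derive z 1 f (2 * h z) -> log_slope (expR \o f) h z.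
Proof.
move=> df; split; first by rewrite gt_eqF ?expR_gt0.
by rewrite mulrC; exact: is_derive1_comp.
Qed.

End LogSlope.

Section DiagChristoffel.
Variables (F : fieldType) (A h : 'I_4 -> F).

(* The Christoffel symbols of [diag_i A_i(z)] when [A_i' = 2 h_i A_i]. *)
Definition diag_christoffel (l m n : 'I_4) : F :=
  h l *+ ((l == n) && (m == zidx)) + h l *+ ((l == m) && (n == zidx))
  - (h m * A m / A l) *+ ((m == n) && (l == zidx)).

Lemma diag_christoffel_trace l m : A l != 0 ->
  diag_christoffel l l m = h l *+ (m == zidx).
Proof.
move=> Al; rewrite /diag_christoffel mulfK // eqxx /=.
by rewrite addrAC subrr add0r.
Qed.

Lemma diag_christoffel_lowerz l n : A l != 0 ->
  diag_christoffel l zidx n = h l *+ (l == n).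
Proof.
move=> Al; rewrite /diag_christoffel eqxx andbT -[RHS]addr0 -addrA.
congr (_ + _); case: (eqVneq l zidx) => [lz|]; last by rewrite andbF subrr.
by rewrite -lz mulfK // eq_sym andbT subrr.
Qed.

Lemma diag_christoffel_transverse l m n : m != zidx ->
  diag_christoffel l m n =
  h l *+ ((l == m) && (n == zidx))
  - (h m * A m / A l) *+ ((m == n) && (l == zidx)).
Proof. by move=> /negPf mz; rewrite /diag_christoffel mz andbF add0r. Qed.

Hypothesis A0 : forall i, A i != 0.

Lemma diag_christoffel_upperz n m :
  diag_christoffel zidx n m =
  (if n == zidx then h zidx else - (h n * A n / A zidx)) *+ (m == n).
Proof.
case: eqVneq => [->|nz]; first by rewrite diag_christoffel_lowerz // eq_sym.
rewrite diag_christoffel_transverse // eq_sym (negPf nz) sub0r mulNrn andbT.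
by rewrite eq_sym.
Qed.

Lemma sum_diag_christoffel_trace l m n :
  \sum_s diag_christoffel l l s * diag_christoffel s n m =
  h l * diag_christoffel zidx n m.
Proof.
rewrite (bigD1 zidx) //= big1 => [|s sz].
  by rewrite diag_christoffel_trace // eqxx addr0.
by rewrite diag_christoffel_trace // (negPf sz) mul0r.
Qed.

Lemma sum_diag_christoffel_cross l m n : l != n ->
  \sum_s diag_christoffel l n s * diag_christoffel s l m =
  (if n == zidx then h l ^+ 2 else - (h n ^+ 2 * A n / A l) *+ (l == zidx))
  *+ (m == n).
Proof.
move=> ln; case: (eqVneq n zidx) ln => [->|nz] ln.
  rewrite (bigD1 l) //= big1 => [|s sl].
    rewrite diag_christoffel_lowerz // diag_christoffel_trace //.
    by rewrite eqxx addr0 mulrnAr.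
  by rewrite diag_christoffel_lowerz // eq_sym (negPf sl) mul0r.
rewrite (bigD1 n) //= big1 => [|s sn].
  rewrite diag_christoffel_transverse // eqxx (negPf ln) /= sub0r addr0.
  case: eqVneq => [->|]; rewrite ?mulr0n ?oppr0 ?mul0r ?mul0rn //.
  rewrite diag_christoffel_lowerz // eq_sym; case: eqP => //= _.
    by rewrite !mulr1n; ring.
  by rewrite !mulr0n mulr0.
rewrite diag_christoffel_transverse // (negPf ln) (eq_sym n) (negPf sn) /=.
by rewrite subr0 mul0r.
Qed.

End DiagChristoffel.

Section DiagMetric.
Variable R : realType.
Implicit Types (x : pt R) (z : R).

Definition diag_field (A : 'I_4 -> R -> R) x : 'M[R]_4 :=
  diag_mx (\row_i A i (zcoord x)).

Lemma pd_diag_field A x (k m n : 'I_4) :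
  pd k (fun y => diag_field A y m n) x =
  derive1 (A m) (zcoord x) *+ ((m == n) && (k == zidx)).
Proof.
under eq_fun do rewrite !mxE.
rewrite (pd_zcoord k (fun z => A m z *+ (m == n))).
by rewrite derive1_mulrb -mulrnA mulnb.
Qed.

Lemma diag_fieldC A x m n : diag_field A x m n = diag_field A x n m.
Proof. by rewrite !mxE eq_sym; case: eqP => [->|]. Qed.

Lemma sum_diag_field_mul A x m (c : 'I_4 -> R) :
  \sum_s diag_field A x m s * c s = A m (zcoord x) * c m.
Proof.
rewrite (bigD1 m) //= big1 => [|s sm]; last first.
  by rewrite mxE eq_sym (negPf sm) mul0r.
by rewrite !mxE eqxx addr0.
Qed.

Lemma ginv_diag A x : (forall i, A i (zcoord x) != 0) ->
  ginv (diag_field A) x = diag_field (fun i z => (A i z)^-1) x.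
Proof.
move=> A0; rewrite /ginv invmx_diag => [|i]; last by rewrite mxE.
by congr diag_mx; apply/rowP => i; rewrite !mxE.
Qed.

Variables A h : 'I_4 -> R -> R.

Definition log_slopes z := forall i, log_slope (A i) (h i) z.

Let g := diag_field A.
Let christoffel l m n z := diag_christoffel (A^~ z) (h^~ z) l m n.

Lemma Gamma_diag x l m n : log_slopes (zcoord x) ->
  Gamma g x l m n = christoffel l m n (zcoord x).
Proof.
move=> slopes; set z := zcoord x.
have A0 i : A i z != 0 by case: (slopes i).
have dA i : derive1 (A i) z = 2 * h i z * A i z.
  by rewrite derive1E; case: (slopes i) => _ /@derive_val.
rewrite /Gamma ginv_diag // -/z sum_diag_field_mul.
rewrite !pd_diag_field !dA -/z /christoffel /diag_christoffel.
by rewrite !mulrb; do 3!case: ifP => _; field.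
Qed.

Lemma pd_Gamma_diag x k l m n : (\forall z \near zcoord x, log_slopes z) ->
  pd k (fun y => Gamma g y l m n) x =
  derive1 (christoffel l m n) (zcoord x) *+ (k == zidx).
Proof.
move=> slopes; rewrite -pd_zcoord.
apply: near_eq_derive; near=> y; apply: Gamma_diag; near: y.
exact: near_zcoord.
Unshelve. all: by end_near. Qed.

Lemma derive1_christoffel_trace l m z : l != zidx ->
  derive1 (christoffel l l m) z = derive1 (h l) z *+ (m == zidx).
Proof.
move=> /negPf lz; rewrite -derive1_mulrb; congr (derive1 _ z).
apply/funext => w.
by rewrite /christoffel /diag_christoffel eqxx lz !andbF subr0 add0r.
Qed.

Lemma derive1_christoffel_upperz m n z :
  m != zidx -> log_slopes z -> derivable (h m) z 1 ->
  derive1 (christoffel zidx m n) z =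
  - ((derive1 (h m) z + 2 * h m z * (h m z - h zidx z)) * A m z / A zidx z)
    *+ (m == n).
Proof.
move=> mz slopes dh.
have [Az0 dAz] := slopes zidx; have [_ dAm] := slopes m.
have dhm : is_derive z 1 (h m) (derive1 (h m) z).
  by rewrite derive1E; exact: derivableP.
have dV := is_deriveV Az0 dAz.
have -> : christoffel zidx m n =
    fun w => - (h m w * A m w / A zidx w) *+ (m == n).
  apply/funext => w; rewrite /christoffel diag_christoffel_transverse //.
  by rewrite eq_sym (negPf mz) andbT sub0r mulNrn.
rewrite derive1_mulrb derive1E; congr (_ *+ _); apply: derive_val.
by apply: is_derive_eq; rewrite /GRing.scale /=; field.
Qed.

Lemma divT_diag T x n : log_slopes (zcoord x) ->
  divT g (diag_field T) x n =
  (derive1 (T n) (zcoord x)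
   + \sum_i h i (zcoord x) * (T zidx (zcoord x) - T i (zcoord x)))
  *+ (n == zidx).
Proof.
move=> slopes; have Ax i : A i (zcoord x) != 0 by case: (slopes i).
rewrite /divT mulrnDl; congr (_ + _).
  rewrite (bigD1 n) //= big1 => [|m mn]; last first.
    by rewrite pd_diag_field (negPf mn).
  by rewrite pd_diag_field eqxx addr0.
rewrite -sumrMnl; apply: eq_bigr => m _.
under eq_bigr => s _ do rewrite diag_fieldC mulrC [X in _ - X]mulrC.
rewrite sumrB !sum_diag_field_mul !Gamma_diag //.
rewrite /christoffel !diag_christoffel_trace //.
by case: eqP => [->|_]; rewrite ?mulr0n ?mulr0 ?subrr // -mulrBl mulrC.
Qed.

(* The curvature [R^{ln}_{ln}] of the plane [(l, n)], multiplied by [- A_z]. *)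
Definition plane_curv z l n : R :=
  let along_z i := derive1 (h i) z + h i z * (h i z - h zidx z) in
  if l == n then 0 else if l == zidx then along_z n
  else if n == zidx then along_z l else h l z * h n z.

Lemma plane_curvC z l n : plane_curv z l n = plane_curv z n l.
Proof.
rewrite /plane_curv eq_sym.
case: (eqVneq n l) => // nl; case: (eqVneq l zidx) => [lz|_].
  by rewrite -lz (negPf nl).
by case: eqP => // _; rewrite mulrC.
Qed.

Section Curvature.
Variable x : pt R.
Hypothesis slopes : \forall z \near zcoord x, log_slopes z.
Hypothesis dh : forall i, i != zidx -> derivable (h i) (zcoord x) 1.

Lemma Riemann_diag l m n :
  Riemann g x l m l n =
  - (A n (zcoord x) / A zidx (zcoord x) * plane_curv (zcoord x) l n)
  *+ (m == n).
Proof.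
rewrite /plane_curv.
have slopesx := nbhs_singleton slopes.
have [ln|ln] := eqVneq l n.
  rewrite ln /Riemann subrr add0r big1 => [|s _]; last by rewrite subrr.
  by rewrite mulr0 oppr0 mul0rn.
have Ax i : A i (zcoord x) != 0 by case: (slopesx i).
rewrite /Riemann !pd_Gamma_diag //.
under eq_bigr => s _ do rewrite !Gamma_diag //.
rewrite sumrB sum_diag_christoffel_trace // sum_diag_christoffel_cross //.
rewrite diag_christoffel_upperz //.
move: ln; have [->|nz] := eqVneq n zidx => ln.
  rewrite (negPf ln) derive1_christoffel_trace // mulr0n mulr1n.
  by rewrite divff //; case: eqP => _; rewrite ?mulr1n ?mulr0n; ring.
have [lz|lz] := eqVneq l zidx; last first.
  by case: (m == n); rewrite ?mulr1n ?mulr0n; ring.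
rewrite lz derive1_christoffel_upperz //; last exact: dh.
rewrite (eq_sym n).
by case: (m == n); rewrite ?mulr1n ?mulr0n; ring.
Qed.

Lemma RicciUp_diag m n :
  RicciUp g x m n =
  - ((A zidx (zcoord x))^-1 * \sum_l plane_curv (zcoord x) l n) *+ (m == n).
Proof.
have Ax i : A i (zcoord x) != 0 by case: (nbhs_singleton slopes i).
rewrite /RicciUp ginv_diag // sum_diag_field_mul /Ricci.
under eq_bigr => l _ do rewrite Riemann_diag //.
rewrite sumrMnl sumrN -mulr_sumr; case: eqP => [->|_]; last by rewrite mulr0.
by rewrite mulrN !mulrA mulVf // mul1r.
Qed.

Lemma einstein_tensor_diag n :
  RicciUp g x n n - 2^-1 * scalarCurv g x =
  (2 * A zidx (zcoord x))^-1 *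
  \sum_(k | k != n) \sum_(l | l != n) plane_curv (zcoord x) l k.
Proof.
have Az0 : A zidx (zcoord x) != 0 by case: (nbhs_singleton slopes zidx).
rewrite /scalarCurv; under eq_bigr => k _ do rewrite RicciUp_diag eqxx mulr1n.
rewrite RicciUp_diag eqxx mulr1n sumrN -mulr_sumr.
rewrite [X in 2^-1 * - (_ * X)](bigD1 n) //=.
under [X in 2^-1 * - (_ * (_ + X))]eq_bigr => k _ do
  rewrite (bigD1 n) //= plane_curvC.
rewrite big_split /= (bigD1 n) //= {1 3}/plane_curv eqxx add0r.
by field.
Qed.

Lemma einstein_eqs_diag Lam T :
  einstein_eqs g Lam (diag_field T) x <->
  forall n, \sum_(k | k != n) \sum_(l | l != n) plane_curv (zcoord x) l k =
    2 * A zidx (zcoord x) * (T n (zcoord x) + Lam).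
Proof.
have Az0 : A zidx (zcoord x) != 0 by case: (nbhs_singleton slopes zidx).
have Az20 : 2 * A zidx (zcoord x) != 0 by rewrite mulf_neq0 ?pnatr_eq0.
split=> [ein n|ein m n].
  apply: (canRL (mulVKf Az20)); rewrite -einstein_tensor_diag.
  have := ein n n; rewrite !mxE eqxx !mulr1 mulr1n => <-.
  by rewrite subrK.
rewrite !mxE; case: (eqVneq m n) => [<-|mn].
  by rewrite !mulr1 mulr1n einstein_tensor_diag ein mulKf // addrK.
by rewrite RicciUp_diag (negPf mn) !mulr0 !subr0.
Qed.

End Curvature.
End DiagMetric.

Definition planar (T : Type) (t s n : T) (i : 'I_4) : T :=
  if val i == 0%N then t else if val i == 3%N then n else s.

Section PlanarMetric.
Variables (R : realType) (A B C a b c : R -> R).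
Implicit Types (x : pt R) (z : R).

Let coefs := planar A (\- B) (\- C).
Let slopes := planar a b c.

Lemma log_slopes_planar z :
  log_slope A a z -> log_slope B b z -> log_slope C c z ->
  log_slopes coefs slopes z.
Proof.
move=> Aa Bb Cc i; rewrite /coefs /slopes /planar.
by case: ifP => // _; case: ifP => _; exact: log_slopeN.
Qed.

Lemma sum_plane_curv_planar z n :
  \sum_(k | k != n) \sum_(l | l != n) plane_curv slopes z l k =
  2 * planar (2 * derive1 b z + 3 * b z ^+ 2 - 2 * b z * c z)
    (derive1 a z + derive1 b z + a z ^+ 2 + a z * b z + b z ^+ 2
      - (a z + b z) * c z)
    (b z ^+ 2 + 2 * a z * b z) n.
Proof.
under eq_bigr => k _ do rewrite big_mkcond !big_ord_recr big_ord0.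
rewrite big_mkcond !big_ord_recr big_ord0.
rewrite /plane_curv /slopes /planar -!val_eqE.
by case: n => -[|[|[|[|n]]]] //= _; ring.
Qed.

Lemma einstein_eqs_planar Lam (rho p q : R -> R) x (z := zcoord x) :
  (\forall w \near z, log_slopes coefs slopes w) ->
  derivable a z 1 -> derivable b z 1 ->
  einstein_eqs (diag_field coefs) Lam
    (diag_field (planar rho (\- p) (\- q))) x <->
  [/\ 2 * derive1 b z + 3 * b z ^+ 2 - 2 * b z * c z = - (rho z + Lam) * C z,
    derive1 a z + derive1 b z + a z ^+ 2 + a z * b z + b z ^+ 2
      - (a z + b z) * c z = (p z - Lam) * C z &
    b z ^+ 2 + 2 * a z * b z = (q z - Lam) * C z].
Proof.
move=> near_slopes da db.
have dslopes i : i != zidx -> derivable (slopes i) z 1.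
  by rewrite -val_eqE /slopes /planar => /negPf /= ->; case: ifP.
rewrite (einstein_eqs_diag near_slopes dslopes) -/z.
split=> [ein|[eq_t eq_s eq_n] n].
  have := ein zidx; have := ein (@Ordinal 4 1 isT).
  have := ein (@Ordinal 4 0 isT).
  rewrite !sum_plane_curv_planar /coefs /planar /=.
  by move=> eq_t eq_s eq_n; split; lra.
rewrite sum_plane_curv_planar eq_t eq_s eq_n /coefs /planar /=.
by case: ifP => _ /=; [ring | case: ifP => _ /=; ring].
Qed.

Lemma divT_planar (rho p q : R -> R) x (z := zcoord x) (n : 'I_4) :
  log_slopes coefs slopes z -> derivable q z 1 ->
  divT (diag_field coefs) (diag_field (planar rho (\- p) (\- q))) x n =
  (- derive1 q z - a z * (rho z + q z) + 2 * b z * (p z - q z)) *+ (n == zidx).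
Proof.
move=> slopesz dq; rewrite (divT_diag _ _ slopesz); case: eqP => // ->.
rewrite !big_ord_recr big_ord0 /= /slopes /planar /= -/z.
by rewrite derive1E deriveN // -derive1E /=; ring.
Qed.

End PlanarMetric.

Lemma smooth_on_derivable (R : realType) (a b : \bar R) (f : R -> R) z :
  smooth_on a b f -> ereal_itv a b z -> derivable f z 1.
Proof. by move=> + abz => /(_ 0%N z abz). Qed.

Section Solution.
Variables (R : realType) (Lam zS : R) (a b : \bar R) (rho p q : R -> R).
Hypotheses (hrho : smooth_on a b rho) (hp : smooth_on a b p)
  (hq : smooth_on a b q).

Let F := Phi Lam zS rho p q.
Let D := Dden Lam zS rho p q.
Let good := good a b Lam zS rho p q.

Lemma derivable_Dden z : ereal_itv a b z -> derivable D z 1.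
Proof.
move=> abz.
have dr := derivableP (smooth_on_derivable hrho abz).
have dp := derivableP (smooth_on_derivable hp abz).
have dq := derivableP (smooth_on_derivable hq abz).
exact: ex_derive.
Qed.

Lemma good_neq0 z : good z ->
  [/\ z - zS != 0, q z - Lam != 0, D z != 0 & F z != 0].
Proof.
move=> [_ [zz [Dz pos]]].
have W0 : z - zS != 0 by rewrite subr_eq0.
have Q0 : q z - Lam != 0.
  by apply: contraTneq pos => ->; rewrite mul0r ltxx.
by split=> //; rewrite /F /Phi !mulf_neq0 ?invr_eq0.
Qed.

Lemma derivable_q_ratio z : good z ->
  derivable (fun w => (q w - Lam) / (w - zS)) z 1.
Proof.
move=> gz; have [W0 _ _ _] := good_neq0 gz; have [abz _] := gz.
have dq := derivableP (smooth_on_derivable hq abz).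
have dW : is_derive z 1 (fun w => w - zS) 1.
  by apply: is_derive_eq; rewrite subr0.
have dV := @is_deriveV _ (fun w => w - zS) _ _ _ W0 dW.
exact: ex_derive.
Qed.

Lemma derivable_Phi z : good z -> derivable F z 1.
Proof.
move=> gz; have [_ _ D0 _] := good_neq0 gz; have [abz _] := gz.
have dQ := derivableP (derivable_q_ratio gz).
have dV := is_deriveV D0 (derivableP (derivable_Dden abz)).
rewrite /F /Phi; exact: ex_derive.
Qed.

Lemma nbhs_good z : good z -> nbhs z good.
Proof.
move=> gz; have [abz [zz [Dz pos]]] := gz.
have near_pos : \forall w \near z, 0 < (q w - Lam) / (w - zS).
  exact: (cvgr_gt _ (derivable_continuous_at (derivable_q_ratio gz)) _ pos).
have near_D : \forall w \near z, D w != 0.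
  exact: (cvgr_neq0 _ (derivable_continuous_at (derivable_Dden abz)) Dz).
near=> w.
have wpos : 0 < (q w - Lam) / (w - zS) by near: w.
split; [|split; [|split]] => //; last by near: w.
- by near: w; exact: nbhs_ereal_itv.
- by apply: contraTneq wpos => ->; rewrite subrr invr0 mulr0 ltxx.
Unshelve. all: by end_near. Qed.

Definition coef_t z := expR (2 * oint 0 z (fun s => (3 * (s - zS) - 1) * F s)).
Definition coef_x z := expR (4 * oint 0 z F).
Definition coef_z z := 12 * (z - zS) / (q z - Lam) * F z ^+ 2.
Definition slope_t z := (3 * (z - zS) - 1) * F z.
Definition slope_x z := 2 * F z.
Definition slope_z z := 2^-1 * ((z - zS)^-1 - derive1 q z / (q z - Lam))
  + derive1 F z / F z.

Definition conservation_ode z := derive1 q z =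
  ((1 - 3 * (z - zS)) * (rho z + q z) + 4 * (p z - q z)) * F z.

Lemma metricE :
  metric Lam zS rho p q = diag_field (planar coef_t (\- coef_x) (\- coef_z)).
Proof.
apply/funext => x; apply/matrixP => i j; rewrite !mxE mulrb /planar.
by case: ifP => // _; case: ifP => // _; case: ifP.
Qed.

Lemma TmatE : Tmat rho p q = diag_field (planar rho (\- p) (\- q)).
Proof.
apply/funext => x; apply/matrixP => i j; rewrite !mxE mulrb /planar.
by case: ifP => // _; case: ifP => // _; case: ifP.
Qed.

Lemma is_derive_slope_t z : good z ->
  is_derive z 1 slope_t (3 * F z + (3 * (z - zS) - 1) * derive1 F z).
Proof.
move=> /derivable_Phi/derivableP; rewrite -derive1E => dF.
by apply: is_derive_eq; rewrite /GRing.scale /=; ring.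
Qed.

Lemma is_derive_slope_x z : good z -> is_derive z 1 slope_x (2 * derive1 F z).
Proof.
move=> /derivable_Phi/derivableP; rewrite -derive1E => dF.
by apply: is_derive_eq; rewrite /GRing.scale /=; ring.
Qed.

Lemma log_slope_coef_z z : good z -> log_slope coef_z slope_z z.
Proof.
move=> gz; have [W0 Q0 D0 F0] := good_neq0 gz; have [abz _] := gz.
split; first by rewrite !mulf_neq0 ?invr_eq0 ?pnatr_eq0 ?expf_neq0.
have dF := derivableP (derivable_Phi gz).
have dq := derivableP (smooth_on_derivable hq abz).
rewrite -derive1E in dF; rewrite -derive1E in dq.
have dQ : is_derive z 1 (fun w => q w - Lam) (derive1 q z).
  by apply: is_derive_eq; rewrite subr0.
have dQV := @is_deriveV _ (fun w => q w - Lam) _ _ _ Q0 dQ.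
have dF2 : is_derive z 1 (fun w => F w * F w) (2 * F z * derive1 F z).
  by apply: is_derive_eq; rewrite /GRing.scale /=; ring.
apply: is_derive_eq; rewrite /coef_z /slope_z /GRing.scale /=; field.
by rewrite W0 Q0 F0.
Qed.

Section GoodInterval.
Variables l u : \bar R.
Hypotheses (lu0 : ereal_itv l u 0) (lu_good : ereal_itv l u `<=` good).

Lemma is_derive_oint_good (f : R -> R) z :
  (forall w, good w -> derivable f w 1) -> ereal_itv l u z ->
  is_derive z 1 (oint 0 ^~ f) (f z).
Proof.
move=> df luz; apply: is_derive_oint lu0 luz => w; rewrite inE => /lu_good gw.
exact/derivable_continuous_at/df.
Qed.

Lemma log_slopes_metric z : ereal_itv l u z ->
  log_slopes (planar coef_t (\- coef_x) (\- coef_z))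
    (planar slope_t slope_x slope_z) z.
Proof.
move=> luz; apply: log_slopes_planar; last exact/log_slope_coef_z/lu_good.
- apply: log_slope_expR.
  have derivable_slope_t w : good w -> derivable slope_t w 1.
    by case/is_derive_slope_t.
  have dA := is_derive_oint_good derivable_slope_t luz.
  exact: is_derive_eq.
- apply: log_slope_expR.
  have dF := is_derive_oint_good derivable_Phi luz.
  by apply: is_derive_eq; rewrite /GRing.scale /slope_x /=; ring.
Qed.

Lemma divT_metric x (n : 'I_4) : ereal_itv l u (zcoord x) ->
  divT (metric Lam zS rho p q) (Tmat rho p q) x n =
  (fun z => ((1 - 3 * (z - zS)) * (rho z + q z) + 4 * (p z - q z)) * F z
      - derive1 q z) (zcoord x) *+ (n == zidx).
Proof.
move=> lux; have [abx _] := lu_good lux.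
rewrite metricE TmatE (divT_planar _ _ _ (log_slopes_metric lux)).
  by congr (_ *+ _); rewrite /slope_t /slope_x; ring.
exact: smooth_on_derivable hq abx.
Qed.

Lemma conservation_iff_ode :
  (forall x : pt R, ereal_itv l u (zcoord x) ->
    forall n : 'I_4, divT (metric Lam zS rho p q) (Tmat rho p q) x n = 0) <->
  (forall z : R, ereal_itv l u z -> conservation_ode z).
Proof.
split=> [conserved z luz|ode_lu x lux n]; last first.
  by rewrite divT_metric // ode_lu // subrr mul0rn.
have zE : zcoord (const_mx z : pt R) = z by rewrite /zcoord mxE.
have := conserved (const_mx z) _ zidx.
rewrite divT_metric zE // eqxx => /(_ luz)/eqP.
by rewrite subr_eq0 => /eqP.
Qed.

Lemma slope_zE z : good z -> conservation_ode z ->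
  slope_z z = derive1 F z / F z
    + 3 * F z * (1 + (z - zS) * (rho z + Lam) / (q z - Lam)).
Proof.
move=> gz ode_z; have [W0 Q0 D0 F0] := good_neq0 gz.
have WE : (z - zS)^-1 = F z * D z / (q z - Lam).
  by rewrite /F /Phi -/(D z); field; rewrite W0 Q0 D0.
rewrite /slope_z WE ode_z /D /Dden; field.
by rewrite Q0 F0.
Qed.

Lemma einstein_metric x :
  ereal_itv l u (zcoord x) -> conservation_ode (zcoord x) ->
  einstein_eqs (metric Lam zS rho p q) Lam (Tmat rho p q) x.
Proof.
set z := zcoord x => luz ode_z.
have gz := lu_good luz; have [W0 Q0 D0 F0] := good_neq0 gz.
have dslope_t := is_derive_slope_t gz; have dslope_x := is_derive_slope_x gz.
have slopes : \forall w \near z,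
    log_slopes (planar coef_t (\- coef_x) (\- coef_z))
      (planar slope_t slope_x slope_z) w.
  by near=> w; apply: log_slopes_metric; near: w; exact: nbhs_ereal_itv.
rewrite metricE TmatE; apply/(einstein_eqs_planar _ _ _ _ slopes) => //.
rewrite (derive1E slope_t) (derive1E slope_x) !derive_val (slope_zE gz ode_z).
rewrite /slope_t /slope_x /coef_z -/z.
split.
- by field; rewrite Q0 F0.
- have FE : 3 * F z = 3 * F z ^+ 2 * ((z - zS) * D z / (q z - Lam)).
    by rewrite /F /Phi -/(D z); field; rewrite W0 Q0 D0.
  by rewrite {1}FE /D /Dden; field; rewrite Q0 F0.
- by field.
Unshelve. all: by end_near. Qed.

End GoodInterval.
End Solution.

Theorem theorem1 (R : realType) (Lam : R) (a b : \bar R) (rho p q : R -> R)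
  (hab : (a < 0%:E < b)%E)
  (hrho : smooth_on a b rho) (hp : smooth_on a b p) (hq : smooth_on a b q)
  (hgen1 : q 0 != Lam)
  (hgen2 : (rho 0 != q 0 - 2 * Lam) \/ (rho 0 + 4 * p 0 + 3 * q 0 != 6 * Lam))
  (zS : R)
  (hzS1 : (q 0 - Lam) / zS < 0)
  (hzS2 : 3 * zS * (rho 0 - q 0 + 2 * Lam) != rho 0 + 4 * p 0 + 3 * q 0 - 6 * Lam) :
  exists l u : \bar R,
    (l < 0%:E < u)%E
    /\ (forall z : R, (l < z%:E < u)%E -> good a b Lam zS rho p q z)
    /\ (forall l' u' : \bar R, (l' < 0%:E < u')%E ->
          (forall z : R, (l' < z%:E < u')%E -> good a b Lam zS rho p q z) ->
          (l <= l')%E /\ (u' <= u)%E)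
    /\ let g := metric Lam zS rho p q in
       let T := Tmat rho p q in
       (* conservation on I0 is equivalent to the ODE for q on I0 *)
       ((forall x : pt R, (l < (zcoord x)%:E < u)%E ->
           forall n : 'I_4, divT g T x n = 0)
        <->
        (forall z : R, (l < z%:E < u)%E ->
           derive1 q z =
             ((1 - 3 * (z - zS)) * (rho z + q z) + 4 * (p z - q z))
               * Phi Lam zS rho p q z))
       /\
       (* provided conservation holds, Einstein's equations hold on I0 *)
       ((forall x : pt R, (l < (zcoord x)%:E < u)%E ->
           forall n : 'I_4, divT g T x n = 0) ->
        forall x : pt R, (l < (zcoord x)%:E < u)%E -> einstein_eqs g Lam T x).
Proof.
have zS0 : zS != 0 by apply: contraTneq hzS1 => ->; rewrite invr0 mulr0 ltxx.
have good0 : good a b Lam zS rho p q 0.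
  split => //; split; first by rewrite eq_sym.
  split; last by rewrite sub0r invrN mulrN oppr_gt0.
  by apply: contraNneq hzS2; rewrite /Dden => D0; apply/eqP; lra.
have [l [u [lu0 lu_good lu_max]]] :=
  maximal_ereal_itv (nbhs_good hrho hp hq good0).
have conservedE := conservation_iff_ode hrho hp hq lu0 lu_good.
exists l, u; do 4![split => //].
move=> /conservedE ode x lux.
by apply: (einstein_metric hrho hp hq lu0 lu_good lux); exact: ode.
Qed.
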